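(* Let $G=(V,E)$ be an undirected graph and $K=\{u_0,u_1,\dots,u_{k-1}\}\subseteq V$. Assume that for every $u_i\in K\setminus\{u_0\}$ there is a collection $\mathcal{Q}_i$ of fractional edge-disjoint paths of length at most $D$ from $u_i$ to $u_0$ in $G$ with total value $p$. Then there is a (fractional) Steiner tree packing in $G$ with terminal set $K$ of value $\tilde{\Omega}(p)$ in which every tree has diameter at most $\tilde{O}(D)$.
   Context: A collection of fractional edge-disjoint paths of total value $p$ is an assignment of nonnegative weights to paths with total weight $p$ such that for every edge $e\in E$ the total weight of paths using $e$ is at most $1$. A fractional Steiner tree packing of value $q$ with diameter at most $\Delta$ is a nonnegative weighting $z_T$ of Steiner trees $T$ of $G$ (trees of $G$ containing all of $K$) in which any two terminals are at distance at most $\Delta$, such that $\sum_{T\ni e}z_T\le 1$ for every $e\in E$ and $\sum_T z_T=q$. $\tilde O,\tilde\Omega$ ignore poly-logarithmic factors (in $|V|$, $k$). *)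

(* Defs.v *)
From HB Require Import structures.
From mathcomp Require Import all_boot all_order all_algebra.
From mathcomp Require Import reals exp.

Set Implicit Arguments.
Unset Strict Implicit.
Unset Printing Implicit Defensive.

Import Order.TTheory GRing.Theory Num.Theory.
Local Open Scope ring_scope.

(* A finite simple undirected graph on the vertex type V is given by its set
   of edges E, each edge being a 2-element set of vertices. *)
Definition simple_graph (V : finType) (E : {set {set V}}) : Prop :=
  forall e : {set V}, e \in E -> #|e| = 2%N.

Definition adj (V : finType) (E : {set {set V}}) : rel V :=
  fun x y => [set x; y] \in E.

(* A path is the sequence of its vertices, endpoints included; its length, the
   number of its edges, is one less than the size of that sequence. *)
Definition is_path (V : finType) (E : {set {set V}}) (u v : V) (s : seq V) :
    Prop :=
  exists s' : seq V,
    [/\ s = u :: s', path (adj E) u s', last u s' = v & uniq s].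

Definition path_length (V : finType) (s : seq V) : nat := (size s).-1.

Definition path_edges (V : finType) (s : seq V) : seq {set V} :=
  [seq [set xy.1; xy.2] | xy <- zip s (behead s)].

(* Paths have no repeated vertex, so they all live in the finite type of
   sequences of at most #|V| vertices. *)
Definition fractional_disjoint_paths (R : realType) (V : finType)
    (E : {set {set V}}) (u v : V) (D : nat) (p : R)
    (w : #|V|.-bseq V -> R) : Prop :=
  [/\ forall s, 0 <= w s,
      forall s, w s != 0 -> is_path E u v s /\ (path_length s <= D)%N,
      forall e, e \in E -> \sum_(s : #|V|.-bseq V | e \in path_edges s) w s <= 1
    & \sum_s w s = p].

(* Subgraphs are pairs (vertex set, edge set). *)
Definition subgraph_of (V : finType) (E : {set {set V}})
    (T : {set V} * {set {set V}}) : Prop :=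
  T.2 \subset E /\ (forall e, e \in T.2 -> e \subset T.1).

Definition is_tree (V : finType) (T : {set V} * {set {set V}}) : Prop :=
  [/\ T.1 != set0,
      forall x y, x \in T.1 -> y \in T.1 -> connect (adj T.2) x y
    & forall c : seq V, (2 < size c)%N -> ~ ucycle (adj T.2) c].

Definition steiner_tree (V : finType) (E : {set {set V}}) (K : {set V})
    (T : {set V} * {set {set V}}) : Prop :=
  [/\ subgraph_of E T, is_tree T & K \subset T.1].

Definition dist_le (R : realType) (V : finType) (E : {set {set V}}) (x y : V)
    (d : R) : Prop :=
  exists s : seq V, is_path E x y s /\ (path_length s)%:R <= d.

Definition terminal_diameter_le (R : realType) (V : finType) (K : {set V})
    (T : {set V} * {set {set V}}) (d : R) : Prop :=
  forall x y, x \in K -> y \in K -> dist_le T.2 x y d.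

Definition steiner_tree_packing (R : realType) (V : finType)
    (E : {set {set V}}) (K : {set V}) (d q : R)
    (z : {set V} * {set {set V}} -> R) : Prop :=
  [/\ forall T, 0 <= z T,
      forall T, z T != 0 -> steiner_tree E K T /\ terminal_diameter_le K T d,
      forall e, e \in E -> \sum_(T : {set V} * {set {set V}} | e \in T.2) z T <= 1
    & \sum_T z T = q].

(* Every poly-logarithmic function of n, k >= 1 is at most C * polylog a n k
   for some constants C and a; the summand 1 keeps it positive at n = k = 1. *)
Definition polylog (R : realType) (a n k : nat) : R :=
  (1 + ln (n%:R : R) + ln (k%:R : R)) ^+ a.

(* Main.v *)
(** By multiplicative weights it suffices to find, for every positive weighting
    [l] of the edges, one Steiner tree of low diameter whose weight is
    [O(log k / p)] times the total weight [L].  Around each terminal [u] take the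
    ball of the vertices reached within [D] edges of total weight at most [r].
    If pairwise disjoint balls are drawn around the terminals of a set [S]
    containing [u0], the paths from [u] to [u0] leave the ball of [u] after
    spending weight [r], so edges of weight at least [p * r] touch that ball,
    while an edge touches at most two balls: [#|S :\ u0| * p * r <= 2 * L].
    Hence a maximal set of terminals with disjoint balls, for [r] of order
    [L / (p * k)], has at most half of the terminals, and every other terminal
    is linked to it by a walk of [2 * D] edges and weight [2 * r].  Iterating
    [log k] times leaves [u0] only; a breadth-first tree of the union of all the
    links is the tree sought. *)
Require Import Defs.
From HB Require Import structures.
From mathcomp Require Import all_boot all_order all_algebra.
From mathcomp Require Import boolp reals exp.
From mathcomp Require Import ring lra.

Set Implicit Arguments.
Unset Strict Implicit.
Unset Printing Implicit Defensive.

Import Order.TTheory GRing.Theory Num.Theory.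
Local Open Scope ring_scope.

(** * Fractional packing by multiplicative weights *)

Lemma sum_count_mem (X : finType) (P : pred X) (ts : seq X) :
  (\sum_(t | P t) count_mem t ts = count P ts)%N.
Proof.
elim: ts => [|s ts IHts] /=; first by rewrite big1.
rewrite big_split /= IHts big_mkcond (bigD1 s) //= eqxx big1 ?addn0; last first.
  by move=> t /negPf ts'; rewrite eq_sym ts' if_same.
by case: (P s).
Qed.

Section MultiplicativeWeights.
Variables (R : realType) (I X : finType).
Variables (E : {set I}) (el : X -> {set I}) (good : X -> Prop) (q : R).
Hypothesis q_gt0 : 0 < q.
Hypothesis cheap : forall l : I -> R, (forall i, 0 < l i) ->
  exists2 t, good t & q * \sum_(i in E | i \in el t) l i <= \sum_(i in E) l i.

(* The weight of [i] doubles each time [i] is covered; a cheap choice at each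
   step keeps the total weight within a factor [1 + q^-1] per step. *)
Lemma greedy_covering (N : nat) : exists ts : seq X,
  [/\ size ts = N, forall t, t \in ts -> good t &
      \sum_(i in E) 2 ^+ count (fun t => i \in el t) ts
        <= #|E|%:R * (1 + q^-1) ^+ N].
Proof.
elim: N => [|N [ts [sz_ts ts_good le_ts]]].
  exists [::]; split=> //.
  by under eq_bigr => i _ do rewrite expr0; rewrite sumr_const expr0 mulr1.
pose l i : R := 2 ^+ count (fun t => i \in el t) ts.
have [|t t_good le_t] := cheap (l := l); first by move=> i; rewrite exprn_gt0.
exists (t :: ts); split => [/=|x|]; first by rewrite sz_ts.
  by rewrite inE => /predU1P[->|/ts_good].
have -> : \sum_(i in E) 2 ^+ count (fun t => i \in el t) (t :: ts) =
    \sum_(i in E) l i + \sum_(i in E | i \in el t) l i.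
  rewrite big_mkcondr -big_split; apply: eq_bigr => i _ /=.
  rewrite /l; case: ifP => _; last by rewrite add0n addr0.
  by rewrite add1n exprS mulr_natl mulr2n.
apply: (@le_trans _ _ ((1 + q^-1) * \sum_(i in E) l i)).
  by rewrite mulrDl mul1r lerD2l mulrC ler_pdivlMr // mulrC.
rewrite exprS mulrCA ler_pM2l //.
by rewrite addr_gt0 // invr_gt0.
Qed.

(** Comparing the weight of one element with the total after [N] greedy steps, an element covered
    [n] times satisfies [n * ln 2 <= ln #|E| + N / q]. For [N > q * ln #|E|] this is below
    [2 * N / q], so weight [q * ln 2 / (2 * N)] per occurrence respects the capacities. *)
Lemma fractional_packing : exists z : X -> R,
  [/\ forall t, 0 <= z t, forall t, z t != 0 -> good t,
      forall i, i \in E -> \sum_(t | i \in el t) z t <= 1 &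
      \sum_t z t = q * ln 2 / 2].
Proof.
have ln2_gt0 : 0 < ln 2 :> R by rewrite ln_gt0 // ltr1n.
have [N ltN N_gt0] : exists2 N : nat, q * ln #|E|%:R < N%:R & 0 < N%:R :> R.
  exists (Num.trunc (q * ln #|E|%:R)).+1; first exact: truncnS_gt.
  by rewrite ltr0n.
have [ts [sz_ts ts_good le_ts]] := greedy_covering N.
pose a : R := q * ln 2 / (2 * N%:R).
have a_ge0 : 0 <= a by rewrite /a; apply/ltW/divr_gt0; apply: mulr_gt0.
have count_sum (P : pred X) :
    \sum_(t | P t) (count_mem t ts)%:R * a = (count P ts)%:R * a.
  rewrite -big_distrl /= -natr_sum; congr (_%:R * a).
  exact: sum_count_mem.
exists (fun t => (count_mem t ts)%:R * a); split => [t|t|i iE|].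
- by rewrite mulr_ge0.
- move=> nz; apply: ts_good; rewrite -has_pred1 has_count lt0n.
  by apply: contraNneq nz => ->; rewrite mul0r.
- rewrite count_sum; set n := count _ _.
  have E_gt0 : 0 < #|E|%:R :> R by rewrite ltr0n; apply/card_gt0P; exists i.
  have q1_gt0 : 0 < 1 + q^-1 by rewrite addr_gt0 // invr_gt0.
  have : 2 ^+ n <= #|E|%:R * (1 + q^-1) ^+ N.
    apply: le_trans le_ts; rewrite (bigD1 i) //= lerDl.
    by rewrite sumr_ge0 // => j _; rewrite exprn_ge0.
  rewrite -ler_ln ?posrE ?exprn_gt0 ?mulr_gt0 ?exprn_gt0 //.
  rewrite lnM ?posrE ?exprn_gt0 // !lnXn //.
  have : ln (1 + q^-1) <= q^-1.
    by apply: le_ln1Dx; rewrite (@lt_trans _ _ 0) ?invr_gt0 // ltrN10.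
  rewrite -(ler_pM2r N_gt0) -[ln (1 + _) *+ N]mulr_natr -[_ *+ n]mulr_natl => le1 le2.
  have le3 : n%:R * ln 2 <= ln #|E|%:R + q^-1 * N%:R :> R by lra.
  rewrite /a mulrA ler_pdivrMr ?mulr_gt0 // mul1r.
  have : q * (n%:R * ln 2) <= q * (ln #|E|%:R + q^-1 * N%:R).
    by rewrite ler_pM2l.
  rewrite mulrDr (mulrA q q^-1) divff ?lt0r_neq0 //.
  by move: ltN; lra.
- rewrite (count_sum predT) count_predT sz_ts /a.
  by field; rewrite lt0r_neq0.
Qed.
End MultiplicativeWeights.

(** * Walks and breadth-first trees *)

Section Walks.
Variable V : finType.
Implicit Types (F : {set {set V}}) (u v x y : V).

(** Vertices may repeat and [n] is only an upper bound, so walks concatenate freely; [walk_dist_le]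
    shortens them to paths. *)
Definition walk F (n : nat) u v : Prop :=
  exists s, [/\ path (adj F) u s, last u s = v & (size s <= n)%N].

Lemma adj_sym F : symmetric (adj F).
Proof. by move=> x y; rewrite /adj setUC. Qed.

Lemma walk0 F n u : walk F n u u.
Proof. by exists [::]. Qed.

Lemma walk_edge F u v : adj F u v -> walk F 1 u v.
Proof. by move=> uv; exists [:: v]; rewrite /= uv. Qed.

Lemma walk_cat F n m u v x : walk F n u v -> walk F m v x -> walk F (n + m) u x.
Proof.
move=> [s [us <- sn]] [t [vt <- tm]]; exists (s ++ t).
by rewrite cat_path us vt last_cat size_cat leq_add.
Qed.

Lemma walk_sym F n u v : walk F n u v -> walk F n v u.
Proof.
move=> [s [us <- sn]]; exists (rev (belast u s)).
rewrite size_rev size_belast; split=> //.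
  by rewrite rev_path (@eq_path _ _ (adj F)) // => x y; rewrite adj_sym.
by case: s us sn => //= x s _ _; rewrite rev_cons last_rcons.
Qed.

Lemma walkS F F' n n' u v :
  F \subset F' -> (n <= n')%N -> walk F n u v -> walk F' n' u v.
Proof.
move=> /subsetP FF' nn' [s [us <- sn]]; exists s; split=> //.
  by apply: sub_path us => x y; apply: FF'.
exact: leq_trans nn'.
Qed.

Lemma walk_dist_le (R : realType) F n u v (d : R) :
  walk F n u v -> n%:R <= d -> dist_le F u v d.
Proof.
move=> [s [us <- sn]] nd.
case: (shortenP us) => t ut Ut ts.
exists (u :: t); split; first by exists t.
rewrite /path_length /=; apply: le_trans nd; rewrite ler_nat.
apply: leq_trans sn; apply: uniq_leq_size => //.
by case/andP: Ut.
Qed.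

Lemma walk_connect F n u v : walk F n u v -> connect (adj F) u v.
Proof. by move=> [s [us <- _]]; apply/connectP; exists s. Qed.

(** For [d] take the distance from [u0], for [par v] the vertex before [v] on a shortest walk. *)
Lemma bfs_parent F u0 : exists (d : V -> nat) (par : V -> V), forall v,
  connect (adj F) u0 v ->
  (forall n, walk F n u0 v -> (d v <= n)%N) /\
  (v != u0 -> [/\ connect (adj F) u0 (par v), adj F (par v) v &
                  (d (par v) < d v)%N]).
Proof.
have [d dP] : exists d : V -> nat, forall v, connect (adj F) u0 v ->
    walk F (d v) u0 v /\ forall n, walk F n u0 v -> (d v <= n)%N.
  apply: (@fin_all_exists V (fun=> nat) (fun v n => connect (adj F) u0 v ->
    walk F n u0 v /\ forall m, walk F m u0 v -> (n <= m)%N)) => v.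
  have [u0v|] := boolP (connect (adj F) u0 v); last by exists 0%N.
  have ex : exists n, `[< walk F n u0 v >].
    case/connectP: u0v => s us ->; exists (size s); apply/asboolP.
    by exists s.
  case: (ex_minnP ex) => n /asboolP nP nmin; exists n => _; split=> // m mP.
  by apply: nmin; apply/asboolP.
have [par parP] : exists par : V -> V, forall v, connect (adj F) u0 v ->
    v != u0 -> [/\ connect (adj F) u0 (par v), adj F (par v) v &
                  (d (par v) < d v)%N].
  apply: (@fin_all_exists V (fun=> V) (fun v x => connect (adj F) u0 v ->
    v != u0 -> [/\ connect (adj F) u0 x, adj F x v & (d x < d v)%N])) => v.
  have [u0v|] := boolP (connect (adj F) u0 v); last by exists v.
  have [s [us]] := (dP v u0v).1.
  case/lastP: s us => [_ <- _|s y].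
    by exists u0; rewrite eqxx.
  rewrite rcons_path last_rcons size_rcons => /andP[us xy] <- sz.
  exists (last u0 s) => _ _.
  have cn : connect (adj F) u0 (last u0 s) by apply/connectP; exists s.
  split=> //; apply: leq_ltn_trans sz; apply: (dP _ cn).2.
  by exists s.
by exists d, par => v u0v; split; [exact: (dP _ u0v).2|exact: parP].
Qed.

(** Keep only the edges from vertices to their parents. Since [d] drops along them, [v] is reached
    from [u0] in at most [d v] edges, which no walk of [F] beats. *)
Lemma bfs_tree F u0 : exists T : {set V} * {set {set V}},
  [/\ subgraph_of F T, is_tree T &
      forall n v, walk F n u0 v -> v \in T.1 /\ walk T.2 n u0 v].
Proof.
have [d [par P]] := bfs_parent F u0.
pose A := [set v | connect (adj F) u0 v].
pose B := [set [set par v; v] | v in A :\ u0].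
have inB v : connect (adj F) u0 v -> v != u0 -> adj B (par v) v.
  by move=> u0v nv; apply/imsetP; exists v => //; rewrite !inE nv.
have walkB v : connect (adj F) u0 v -> walk B (d v) u0 v.
  have [n] := ubnP (d v); elim: n v => // n IHn v.
  rewrite ltnS => dn u0v; have [->|nv] := eqVneq v u0; first exact: walk0.
  have [_ /(_ nv)[u0p pv dp]] := P _ u0v.
  apply: (@walkS B B (d (par v) + 1)); rewrite ?addn1 //.
  rewrite -addn1; apply: walk_cat (walk_edge (inB _ u0v nv)).
  by apply: IHn => //; apply: leq_trans dn.
exists (A, B); split; [split=> /=|split=> /=|].
- apply/subsetP => e /imsetP[v]; rewrite !inE => /andP[nv u0v] ->.
  by have [_ /(_ nv)[_ pv _]] := P _ u0v; exact: pv.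
- move=> e /imsetP[v]; rewrite !inE => /andP[nv u0v] ->.
  have [_ /(_ nv)[u0p _ _]] := P _ u0v.
  by apply/subsetP => x; rewrite !inE => /orP[]/eqP->.
- by apply/set0Pn; exists u0; rewrite inE connect0.
- move=> x y; rewrite !inE => /walkB/walk_sym xu0 /walkB u0y.
  exact: walk_connect (walk_cat xu0 u0y).
- (* At a deepest vertex of a cycle both neighbours would be its parent. *)
  move=> c szc cyc.
  have [x0 x0c] : exists x, x \in c.
    by case: c szc {cyc} => // x c _; exists x; rewrite mem_head.
  case: (@arg_maxnP _ x0 (mem c) d x0c) => x xc xmax.
  (* The edge joins some [v] to [par v], and [d (par v) < d v <= d x] rules out [x = par v]. *)
  have par_nbr y : y \in c -> adj B x y -> y = par x.
    move=> yc /imsetP[v]; rewrite !inE => /andP[nv u0v] exy.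
    have [_ /(_ nv)[_ _ dv]] := P _ u0v.
    have vc : v \in c.
      have : v \in [set x; y] by rewrite exy !inE eqxx orbT.
      by rewrite !inE => /orP[]/eqP->.
    have vx : v = x.
      have : x \in [set par v; v] by rewrite -exy !inE eqxx.
      rewrite !inE => /orP[]/eqP // xp.
      have : (d v <= d x)%N := xmax _ vc.
      by rewrite xp leqNgt dv.
    have : par x \in [set x; y] by rewrite exy vx !inE eqxx.
    rewrite !inE => /orP[]/eqP // px.
    by move: dv; rewrite vx px ltnn.
  have [i s Es] := rot_to xc.
  have mem_s y : y \in s -> y \in c.
    by move=> ys; rewrite -(mem_rot i) Es inE ys orbT.
  move: cyc szc; rewrite -(rot_ucycle i) -(size_rot i) Es.
  case: s {Es} mem_s => [|y [|z s]] // mem_s /andP[/= /andP[xy]].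
  rewrite rcons_path => /andP[_ /andP[_ lx]] /and3P[_ yzs _] _.
  move: yzs; rewrite (par_nbr y) // ?mem_s ?mem_head //.
  rewrite -(par_nbr (last z s)) ?mem_last // 1?adj_sym //.
  by rewrite mem_s // inE mem_last orbT.
- move=> n v wv; have u0v := walk_connect wv; rewrite inE; split=> //.
  exact: walkS (subxx _) ((P _ u0v).1 _ wv) (walkB _ u0v).
Qed.
End Walks.

(** * Balls, nets and cheap connecting subgraphs *)

Section CheapTree.
Variables (R : realType) (V : finType) (E : {set {set V}}) (l : {set V} -> R).
Hypothesis l_ge0 : forall e, 0 <= l e.
Implicit Types (F : {set {set V}}) (u v x : V).

Definition cost F : R := \sum_(e in F) l e.

Lemma costU F F' : cost (F :|: F') <= cost F + cost F'.
Proof.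
rewrite /cost [X in X <= _]big_mkcond /= (big_mkcond (mem F)) /=.
rewrite (big_mkcond (mem F')) -big_split /=; apply: ler_sum => e _.
by rewrite !inE; case: (e \in F); case: (e \in F'); rewrite ?addr0 ?add0r ?lerDl.
Qed.

Lemma costS F F' : F \subset F' -> cost F <= cost F'.
Proof.
move=> FF'; rewrite /cost [X in _ <= X](big_setID F) /= (setIidPr FF') lerDl.
exact: sumr_ge0.
Qed.

Lemma cost_bigcup (I : finType) (A : {set I}) (F : I -> {set {set V}}) (r : R) :
  (forall i, i \in A -> cost (F i) <= r) ->
  cost (\bigcup_(i in A) F i) <= #|A|%:R * r.
Proof.
move=> Fr; rewrite mulr_natl -sumr_const.
elim/big_rec2: _ => [|i S a /Fr Fi le_a]; first by rewrite /cost big_set0.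
by apply: le_trans (costU _ _) _; apply: lerD.
Qed.

(** Cost is charged to an edge set containing the walk, so an edge used twice is paid once and links
    combine by union. *)
Definition near (n : nat) (r : R) u v : Prop :=
  exists F, [/\ F \subset E, cost F <= r & walk F n u v].

Lemma near_sym n r u v : near n r u v -> near n r v u.
Proof. by move=> [F [FE Fr uv]]; exists F; split=> //; apply: walk_sym. Qed.

Lemma near_trans n m r t u v x :
  near n r u v -> near m t v x -> near (n + m) (r + t) u x.
Proof.
move=> [F [FE Fr uv]] [F' [FE' Fr' vx]]; exists (F :|: F'); split.
- by rewrite subUset FE.
- by apply: le_trans (costU _ _) _; apply: lerD.
- by apply: walk_cat; [apply: walkS uv|apply: walkS vx];
    rewrite // ?subsetUl ?subsetUr.
Qed.

Definition ball (n : nat) (r : R) u : {set V} := [set v | `[< near n r u v >]].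

Lemma in_ball n r u v : reflect (near n r u v) (v \in ball n r u).
Proof. by rewrite inE; apply: asboolP. Qed.

(** Edges leaving the ball are included, so the edge by which a path first exits is charged too. *)
Definition touch (B : {set V}) : {set {set V}} :=
  [set e in E | [exists x in B, x \in e]].

(* The part of the path up to its first vertex outside the ball has few edges,
   so only its cost can keep that vertex outside. *)
Lemma cost_escape n (r : R) u v s :
  is_path E u v s -> (path_length s <= n)%N -> v \notin ball n r u ->
  r <= cost [set e in touch (ball n r u) | e \in path_edges s].
Proof.
move=> [t [-> ut <- _]]; rewrite /path_length /= => tn vB.
rewrite leNgt; apply: contra vB; set A := [set _ in _ | _] => /ltW Ar.
have AE : A \subset E.
  by apply/subsetP => e; rewrite inE => /andP[]; rewrite inE => /andP[].
have pre_ball t1 : path (adj A) u t1 -> (size t1 <= n)%N ->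
    last u t1 \in ball n r u.
  by move=> ut1 szt1; apply/in_ball; exists A; split=> //; exists t1.
(* Induction on prefixes: a prefix with edges in [A], of cost at most [r], ends in the ball, so the
   next edge touches the ball and lies in [A] too. *)
suff pre t1 t2 : t = t1 ++ t2 -> path (adj A) u t1.
  by apply: pre_ball => //; apply: (pre _ [::]); rewrite cats0.
elim/last_ind: t1 t2 => // t1 y IH t2 Et.
have ut1 : path (adj A) u t1 by apply: IH (y :: t2) _; rewrite -cat_rcons.
rewrite rcons_path ut1 /=.
have le1 : (size t1 <= n)%N.
  by apply: leq_trans tn; rewrite Et size_cat size_rcons addSn ltnW ?ltnS ?leq_addr.
rewrite /adj !inE; apply/andP; split; last first.
  apply/mapP; exists (last u t1, y) => //=; rewrite Et.
  elim: {IH Et ut1 le1} t1 (u) => [|a t1 IHt] z /=; first by rewrite mem_head.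
  by rewrite inE IHt orbT.
apply/andP; split.
  by move: ut; rewrite Et cat_path rcons_path => /andP[/andP[]].
by apply/existsP; exists (last u t1); rewrite pre_ball // !inE eqxx.
Qed.

(** Every path of positive weight ends outside the ball, hence spends at least [r] on edges touching
    it. Summed over all paths, an edge is charged at most [l e] by the capacity bound. *)
Lemma ball_cost D (p r : R) u v w : fractional_disjoint_paths E u v D p w ->
  v \notin ball D r u -> p * r <= cost (touch (ball D r u)).
Proof.
move=> [w_ge0 w_path w_cap <-] vB; set B := ball D r u.
rewrite mulr_suml.
apply: (@le_trans _ _ (\sum_(s : #|V|.-bseq V)
    \sum_(e in touch B | e \in path_edges s) w s * l e)).
  apply: ler_sum => s _; have [->|nz] := eqVneq (w s) 0.
    by rewrite mul0r sumr_ge0 // => e _; rewrite mul0r.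
  have [ps szs] := w_path s nz; rewrite -mulr_sumr ler_wpM2l //.
  apply: le_trans (cost_escape ps szs vB) _.
  by rewrite le_eqVlt; apply/predU1P; left; apply: eq_bigl => e; rewrite !inE.
rewrite (exchange_big_dep (mem (touch B))) /=; last by move=> s e _ /andP[].
apply: ler_sum => e eB; rewrite -mulr_suml.
rewrite (eq_bigl (fun s : #|V|.-bseq V => e \in path_edges s)); last first.
  by move=> s; rewrite eB.
by rewrite ler_piMl // w_cap //; move: eB; rewrite inE => /andP[].
Qed.

(** Add up [ball_cost] over [S :\ v]. An edge has two endpoints, and separation puts each in at most
    one ball, so every edge counts at most twice. *)
Lemma card_net D (p r : R) v (S : {set V}) : simple_graph E ->
  (forall u, u \in S :\ v -> exists w : #|V|.-bseq V -> R,
     fractional_disjoint_paths E u v D p w) ->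
  0 <= r -> v \in S ->
  {in S &, forall x y, x != y -> ~ near (D + D) (r + r) x y} ->
  #|S :\ v|%:R * (p * r) <= 2 * cost E.
Proof.
move=> sE paths r_ge0 vS sep.
rewrite mulr_natl -sumr_const.
apply: (@le_trans _ _ (\sum_(u in S :\ v) cost (touch (ball D r u)))).
  apply: ler_sum => u uS; have [w wP] := paths u uS.
  (* A ball containing [v] would contradict separation: the empty link from [v] to itself pads the
     bounds [D] and [r] to [D + D] and [r + r]. *)
  apply: (ball_cost wP); apply/negP => /in_ball uv.
  move: uS; rewrite !inE => /andP[nuv uS].
  apply: (sep u v uS vS nuv); apply: near_trans uv _.
  by exists set0; split; rewrite ?sub0set /cost ?big_set0 //; apply: walk0.
rewrite /cost.
rewrite (exchange_big_dep (mem E)) /=; last first.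
  by move=> u e _; rewrite inE => /andP[].
rewrite mulr_sumr; apply: ler_sum => e eE.
rewrite sumr_const -[_ *+ _]mulr_natl ler_wpM2r // ler_nat.
rewrite -(sE e eE) -[#|e|]sum1_card.
(* Charge an edge touching the ball of [u] to an endpoint in that ball. *)
apply: (@leq_trans (\sum_(x in e) #|[set u in S | x \in ball D r u]|)).
  rewrite -sum1_card.
  under [X in (_ <= X)%N]eq_bigr => x _ do rewrite -sum1_card.
  rewrite (exchange_big_dep (mem S)) /=; last first.
    by move=> x u _; rewrite inE => /andP[].
  rewrite [X in (X <= _)%N]big_mkcond [X in (_ <= X)%N]big_mkcond /=.
  apply: leq_sum => u _; case: ifP => // /andP[].
  rewrite !inE => /andP[_ uS] /andP[_ /existsP[x /andP[xB xe]]].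
  by rewrite uS (bigD1 x) // xe inE uS xB.
apply: leq_sum => x _; apply/card_le1_eqP => y z.
rewrite !inE => /andP[yS /asboolP yx] /andP[zS /asboolP zx].
have [//|nyz] := eqVneq y z; case: (sep y z yS zS nyz).
exact: near_trans yx (near_sym zx).
Qed.

(** Take a maximal separated set containing [v]: a point of [S] far from all of it could be
    added. *)
Lemma net_exists n (r : R) v (S : {set V}) : v \in S ->
  exists S' : {set V},
  [/\ v \in S', S' \subset S,
      {in S' &, forall x y, x != y -> ~ near n r x y} &
      forall x, x \in S -> x \notin S' -> exists2 y, y \in S' & near n r x y].
Proof.
move=> vS.
pose sep (A : {set V}) := (A \subset S) &&
  [forall x in A, forall y in A, (x != y) ==> ~~ `[< near n r x y >]].
have sepP (A : {set V}) : reflect (A \subset S /\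
    {in A &, forall x y, x != y -> ~ near n r x y}) (sep A).
  apply: (iffP andP) => -[AS H]; split=> //.
    move=> x y xA yA nxy; apply/asboolPn.
    by move/forall_inP/(_ x xA)/forall_inP/(_ y yA)/implyP: H; apply.
  apply/forall_inP => x xA; apply/forall_inP => y yA; apply/implyP => nxy.
  exact/asboolPn/H.
have [|A /maxsetP[/sepP[AS Asep] Amax]] := @maxset_exists _ sep [set v].
  apply/sepP; rewrite sub1set vS; split=> // x y.
  by rewrite !inE => /eqP-> /eqP->; rewrite eqxx.
rewrite sub1set => vA; exists A; split=> // x xS xA.
apply: contrapT => far; move/negP: xA; apply.
suff /Amax <- : sep (x |: A) by rewrite ?setU11 ?subsetUr.
apply/sepP; rewrite subUset sub1set xS; split=> // y z.
rewrite !inE => /predU1P[->|yA] /predU1P[->|zA]; last exact: Asep.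
- by rewrite eqxx.
- by move=> _ xz; apply: far; exists z.
- by move=> _ yx; apply: far; exists y => //; apply: near_sym.
Qed.

Hypothesis sE : simple_graph E.
Hypothesis L_gt0 : 0 < cost E.
Variables (K : {set V}) (u0 : V) (D : nat) (p : R).
Hypothesis p_gt0 : 0 < p.
Hypothesis paths : forall u, u \in K :\ u0 -> exists w : #|V|.-bseq V -> R,
  fractional_disjoint_paths E u u0 D p w.

(* Each step passes from [S] to a net at most half its size; the radius
   [4 * cost E / (p * m)], for [m] the number of points to be linked, makes the
   links cost [8 * cost E / p] in total whatever [m] is. *)
Lemma cheap_subgraph j (S : {set V}) : S \subset K -> u0 \in S ->
  (#|S :\ u0| < 2 ^ j)%N ->
  exists F, [/\ F \subset E, cost F <= j%:R * (8 * cost E / p) &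
    forall u, u \in S -> walk F (j * (D + D)) u0 u].
Proof.
elim: j S => [|j IHj] S SK u0S Sj.
  exists set0; rewrite sub0set /cost big_set0 mul0r; split=> // u uS.
  have [->|nu] := eqVneq u u0; first exact: walk0.
  by move: Sj; rewrite ltnS leqn0 cards_eq0 => /eqP/setP/(_ u); rewrite !inE nu uS.
(* If only [u0] is left there is nothing to link, and the radius chosen below would divide by
   zero. *)
have [m0|m_gt0] := posnP #|S :\ u0|.
  exists set0; rewrite sub0set /cost big_set0; split=> // [|u uS].
    by rewrite mulr_ge0 // divr_ge0 ?mulr_ge0 ?ltW.
  have [->|nu] := eqVneq u u0; first exact: walk0.
  by move/eqP: m0; rewrite cards_eq0 => /eqP/setP/(_ u); rewrite !inE nu uS.
set m := #|S :\ u0| in m_gt0 Sj *.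
have mR_gt0 : 0 < m%:R :> R by rewrite ltr0n.
pose r : R := 4 * cost E / (p * m%:R).
have r_gt0 : 0 < r by rewrite divr_gt0 // mulr_gt0.
have [A [u0A AS Asep Adom]] := net_exists (D + D) (r + r) u0S.
(* With this [r], [card_net] reads [#|A :\ u0| * (4 * cost E / m) <= 2 * cost E]. *)
have card_A : (2 * #|A :\ u0| <= m)%N.
  have Apaths u (uA : u \in A :\ u0) :=
    paths (subsetP (setSD _ (subset_trans AS SK)) u uA).
  have := card_net sE Apaths (ltW r_gt0) u0A Asep.
  have -> : p * r = 4 * cost E / m%:R by rewrite /r; field; rewrite !lt0r_neq0.
  rewrite mulrA ler_pdivrMr // mulrA (mulrAC 2) ler_pM2r // => le_A.
  by rewrite -(ler_nat R) natrM; lra.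
have [|F [FE Fcost Fwalk]] := IHj A (subset_trans AS SK) u0A.
  by rewrite -(ltn_pmul2l (ltn0Sn 1)) -expnS (leq_ltn_trans card_A).
have [G GP] : exists G : V -> {set {set V}}, forall u, u \in S ->
    [/\ G u \subset E, cost (G u) <= r + r &
        exists2 y, y \in A & walk (G u) (D + D) u y].
  apply: (@fin_all_exists V (fun=> {set {set V}}) (fun u H => u \in S ->
    [/\ H \subset E, cost H <= r + r &
        exists2 y, y \in A & walk H (D + D) u y])) => u.
  have [uS|] := boolP (u \in S); last by exists set0.
  have [uA|nuA] := boolP (u \in A).
    exists set0 => _; rewrite sub0set /cost big_set0 addr_ge0 ?ltW //; split=> //.
    by exists u => //; apply: walk0.
  have [y yA [H [HE Hr uy]]] := Adom u uS nuA.
  by exists H => _; split=> //; exists y.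
exists (\bigcup_(u in S :\ u0) G u :|: F); split.
- rewrite subUset FE andbT; apply/bigcupsP => u /setD1P[_ /GP[]] //.
- apply: le_trans (costU _ _) _; rewrite -natr1 mulrDl mul1r addrC lerD //.
  apply: (@le_trans _ _ (m%:R * (r + r))).
    by apply: cost_bigcup => u /setD1P[_ /GP[]].
  by rewrite le_eqVlt; apply/predU1P; left; rewrite /r; field; rewrite !lt0r_neq0.
- move=> u uS; have [->|nu] := eqVneq u u0; first exact: walk0.
  have [_ _ [y yA uy]] := GP u uS; rewrite mulSn addnC.
  apply: walk_cat (walkS (subsetUr _ _) (leqnn _) (Fwalk y yA)) _.
  apply/walk_sym/walkS/uy => //; apply: subset_trans (subsetUl _ _).
  by apply: bigcup_sup; rewrite !inE nu.
Qed.

(** Any two terminals are joined through [u0] by two tree walks of at most [j * (D + D)] edges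
    each. *)
Lemma cheap_steiner_tree j : u0 \in K -> (#|K :\ u0| < 2 ^ j)%N ->
  exists2 T, steiner_tree E K T /\
    terminal_diameter_le K T ((j * (D + D) + j * (D + D))%:R : R) &
  cost T.2 <= j%:R * (8 * cost E / p).
Proof.
move=> u0K Kj; have [F [FE Fcost Fwalk]] := cheap_subgraph (subxx K) u0K Kj.
have [T [[TF Tsub] Ttree Twalk]] := bfs_tree F u0.
exists T; last exact: le_trans (costS TF) Fcost.
split; first split.
- by split=> //; apply: subset_trans FE.
- exact: Ttree.
- by apply/subsetP => u /Fwalk/Twalk[].
- move=> x y /Fwalk/Twalk[_ /walk_sym wx] /Fwalk/Twalk[_ wy].
  exact: walk_dist_le (walk_cat wx wy) _.
Qed.
End CheapTree.

(** * Degenerate cases, constants and assembly *)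

Lemma disjoint_paths_ge0 (R : realType) (V : finType) (E : {set {set V}})
    (u v : V) (D : nat) (p : R) w :
  fractional_disjoint_paths E u v D p w -> 0 <= p.
Proof. by move=> [w_ge0 _ _ <-]; apply: sumr_ge0. Qed.

(** Supplies an edge, so that every positive weighting of [E] has positive total. *)
Lemma disjoint_paths_edge (R : realType) (V : finType) (E : {set {set V}})
    (u v : V) (D : nat) (p : R) w :
  fractional_disjoint_paths E u v D p w -> u != v -> 0 < p -> E != set0.
Proof.
move=> [_ w_path _ <-] nuv; apply: contraTneq => E0.
rewrite big1 ?ltxx // => s _; apply/eqP; apply: contraNT nuv => /w_path[].
move=> [[|x t] [_ ut last_t _] _]; first by rewrite -last_t.
by move: ut; rewrite /= /adj E0 inE.
Qed.

(** A one-vertex tree uses no edge, so the capacities allow any value [q]. *)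
Lemma trivial_packing (R : realType) (V : finType) (E : {set {set V}})
    (u : V) (d q : R) : 0 <= d -> 0 <= q ->
  steiner_tree_packing E [set u] d q
    (fun T => if T == ([set u], set0) then q else 0).
Proof.
move=> d_ge0 q_ge0; split=> [T|T|e _|].
- by case: ifP.
- case: ifP => [/eqP-> _|]; last by rewrite eqxx.
  split; last first.
    move=> x y; rewrite !inE => /eqP-> /eqP->.
    exact: walk_dist_le (walk0 _ 0 _) _.
  split=> //; first by split=> [|e]; rewrite ?sub0set ?inE.
  split=> [|x y|c].
  + by apply/set0Pn; exists u; rewrite inE.
  + by rewrite !inE => /eqP-> /eqP->; apply: connect0.
  + by case: c => [|x [|y c]] //= _ /andP[] /=; rewrite /adj inE.
- rewrite big1 // => T eT; case: ifP => // /eqP T0.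
  by move: eT; rewrite T0 inE.
- by rewrite -big_mkcond big_pred1_eq.
Qed.

Lemma terminal_diameter_leW (R : realType) (V : finType) (K : {set V}) T
    (d d' : R) :
  d <= d' -> terminal_diameter_le K T d -> terminal_diameter_le K T d'.
Proof.
move=> dd' Kd x y xK yK; have [s [sP sd]] := Kd x y xK yK.
by exists s; split=> //; apply: le_trans dd'.
Qed.

(** From [2 ^ t <= k] follows [t + 1 <= 1 + ln k / ln 2]. *)
Lemma trunc_log2_le_polylog (R : realType) (n k : nat) : (0 < n)%N -> (0 < k)%N ->
  (trunc_log 2 k).+1%:R <= (1 + (ln 2)^-1) * polylog R 1 n k.
Proof.
move=> n_gt0 k_gt0; set t := trunc_log 2 k; rewrite /polylog expr1.
have ln2_gt0 : 0 < ln 2 :> R by rewrite ln_gt0 // ltr1n.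
have lnn_ge0 : 0 <= ln n%:R :> R by rewrite ln_ge0 // ler1n.
have lnk_ge0 : 0 <= ln k%:R :> R by rewrite ln_ge0 // ler1n.
have : t%:R <= (ln 2)^-1 * ln k%:R :> R.
  rewrite mulrC ler_pdivlMr // mulr_natl -lnXn // -natrX.
  by rewrite ler_ln ?posrE ?ltr0n ?expn_gt0 // ler_nat trunc_logP.
rewrite -natr1 mulrDl mul1r => le_t.
have i_gt0 : 0 < (ln 2)^-1 :> R by rewrite invr_gt0.
have := mulr_ge0 (ltW i_gt0) lnn_ge0.
by lra.
Qed.

Theorem theorem4p2 (R : realType) :
  exists (c C : R) (a b : nat),
    [/\ 0 < c, 0 < C &
      forall (V : finType) (E : {set {set V}}) (K : {set V}) (u0 : V)
             (D : nat) (p : R),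
        simple_graph E -> u0 \in K ->
        (forall u : V, u \in K :\ u0 ->
           exists w : #|V|.-bseq V -> R,
             fractional_disjoint_paths E u u0 D p w) ->
        exists (q : R) (z : {set V} * {set {set V}} -> R),
          c * p / polylog R a #|V| #|K| <= q /\
          steiner_tree_packing E K (C * D%:R * polylog R b #|V| #|K|) q z].
Proof.
have ln2_gt0 : 0 < ln 2 :> R by rewrite ln_gt0 // ltr1n.
pose k : R := 1 + (ln 2)^-1.
have k_gt0 : 0 < k by rewrite addr_gt0 // invr_gt0.
(* Trees of cost at most [8 * j / p] times the total give value [p * ln 2 / (16 * j)] and terminal
   diameter [4 * j * D]; both constants come from [j <= k * P]. *)
exists (ln 2 / (16 * k)), (4 * k), 1%N, 1%N; split.
- by rewrite divr_gt0 // mulr_gt0.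
- by rewrite mulr_gt0.
move=> V E K u0 D p sE u0K paths.
set P := polylog R 1 #|V| #|K|; pose j := (trunc_log 2 #|K|).+1.
have le_j : j%:R <= k * P.
  by apply: trunc_log2_le_polylog; apply/card_gt0P; exists u0.
have j_gt0 : 0 < j%:R :> R by rewrite ltr0n.
have P_gt0 : 0 < P by rewrite -(pmulr_rgt0 _ k_gt0) (lt_le_trans j_gt0).
have d_ge0 : 0 <= 4 * k * D%:R * P by rewrite !mulr_ge0 // ltW.
have [K0|[u uK]] := set_0Vmem (K :\ u0).
  have -> : K = [set u0] by rewrite -(setD1K u0K) K0 setU0.
  (* When [u0] is the only terminal, [p] may be negative, hence the absolute value. *)
  exists `|ln 2 / (16 * k) * p / P|; eexists; split; first exact: ler_norm.
  exact: trivial_packing.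
have [w wP] := paths u uK.
have := disjoint_paths_ge0 wP; rewrite le_eqVlt => /predU1P[p0|p_gt0].
  exists 0, (fun=> 0); rewrite -p0 mulr0 mul0r; split=> //.
  split=> // [T|e _|]; first by rewrite eqxx.
    by rewrite big1.
  by rewrite big1.
have nu : u != u0 by move: uK; rewrite !inE => /andP[].
have /set0Pn[e eE] := disjoint_paths_edge wP nu p_gt0.
have Kj : (#|K :\ u0| < 2 ^ j)%N.
  apply: leq_ltn_trans (trunc_log_ltn _ (isT : 1 < 2)%N).
  by rewrite subset_leq_card // subD1set.
have q_gt0 : 0 < p / (8 * j%:R) by rewrite divr_gt0 // mulr_gt0.
have [|z [z_ge0 z_good z_cap z_sum]] := @fractional_packing R _ _ E
    (fun T : {set V} * {set {set V}} => T.2)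
    (fun T => steiner_tree E K T /\
       terminal_diameter_le K T (4 * k * D%:R * P)) _ q_gt0.
  move=> l l_gt0; have l_ge0 x : 0 <= l x by rewrite ltW.
  have L_gt0 : 0 < cost l E.
    by rewrite /cost (bigD1 e) //= ltr_pwDl // sumr_ge0.
  have [T [Tst Tdiam] Tcost] :=
    cheap_steiner_tree l_ge0 sE L_gt0 p_gt0 paths u0K Kj.
  exists T.
    split=> //; apply: terminal_diameter_leW Tdiam.
    rewrite -!mulnDr natrM !natrD.
    have := ler_wpM2r (ler0n R D) le_j; lra.
  rewrite (eq_bigl (mem T.2)); last first.
    case: Tst => [[/subsetP TE _] _ _] x /=.
    by apply/andP/idP => [[]|xT] //; split=> //; apply: TE.
  rewrite mulrAC ler_pdivrMr ?mulr_gt0 //.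
  move: Tcost; rewrite mulrA ler_pdivlMr // /cost => Tcost.
  rewrite [X in X <= _]mulrC (le_trans Tcost) // le_eqVlt.
  by apply/predU1P; left; ring.
exists (p / (8 * j%:R) * ln 2 / 2), z; split; last by split.
have -> : p / (8 * j%:R) * ln 2 / 2 = ln 2 * p / 16 * j%:R^-1.
  by field; rewrite lt0r_neq0.
have -> : ln 2 / (16 * k) * p / P = ln 2 * p / 16 * (k * P)^-1.
  by field; rewrite !lt0r_neq0.
by rewrite ler_wpM2l ?lef_pV2 ?posrE ?mulr_gt0 // divr_ge0 // mulr_ge0 // ltW.
Qed.
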